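(* Let $(A,\star)$ be an associative formal deformation of an associative algebra $(A,\mu_0)$ over a field $\mathbb K$ of characteristic $0$, with $\star=\mu_0+t\mu_1+t^2\mu_2+\cdots$. Let $\alpha:A\to A$ be a morphism such that $\alpha\circ\mu_i=\mu_i\circ\alpha^{\otimes2}$ for all $i\in\mathbb N$. Then $(A,\star_\alpha=\alpha\circ\star,\alpha)$ is a Hom-associative deformation of $A$ (that is, of the Hom-associative algebra $(A,\alpha\circ\mu_0,\alpha)$).
   Context: A formal deformation of an associative algebra $(A,\mu_0)$ is a $\mathbb K[[t]]$-bilinear associative product $\star=\sum_{i\ge0}\mu_it^i$ on $A[[t]]$, where each $\mu_i:A\otimes A\to A$ is $\mathbb K$-bilinear (extended $\mathbb K[[t]]$-bilinearly). The map $\alpha$ is $\mathbb K$-linear and extended $\mathbb K[[t]]$-linearly to $A[[t]]$; $\star_\alpha=\sum_{i\ge0}(\alpha\circ\mu_i)t^i$. A Hom-associative algebra is a triple $(A,\mu,\alpha)$ with $\mu$ bilinear and $\alpha$ linear such that $\mu(\mu(x,y),\alpha(z))=\mu(\alpha(x),\mu(y,z))$. A formal Hom-associative deformation of a Hom-associative algebra $(A,\nu_0,\alpha)$ is a $\mathbb K[[t]]$-bilinear map $\nu_t=\sum_{i\ge0}\nu_it^i$ on $A[[t]]$, with each $\nu_i:A\otimes A\to A$ $\mathbb K$-bilinear, such that $\nu_t\circ(\nu_t\otimes\alpha-\alpha\otimes\nu_t)=0$. *)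

(* Defs.v *)
From HB Require Import structures.
From mathcomp Require Import all_boot all_algebra.
From mathcomp Require Import boolp functions.

Set Implicit Arguments.
Unset Strict Implicit.
Unset Printing Implicit Defensive.

Import GRing.Theory.
Local Open Scope ring_scope.

(* [fps V] is V[[t]]: the series \sum_n x_n t^n is its coefficient sequence
   n |-> x n.  Its additive structure is the pointwise one of nat -> V, but its
   ring and module structures below are convolutions, not the pointwise
   structures that mathcomp puts on function types. *)
Definition fps (V : Type) := nat -> V.

HB.instance Definition _ (V : zmodType) := GRing.Zmodule.copy (fps V) (nat -> V).

Section Convolution.

(* The coefficientwise extension of a biadditive f : U x V -> W to
   U[[t]] x V[[t]] -> W[[t]], i.e. f (u t^i, v t^j) = f (u, v) t^(i + j). *)
Definition conv (U V : Type) (W : zmodType) (f : U -> V -> W)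
    (x : fps U) (y : fps V) : fps W :=
  fun n => \sum_(j < n.+1) f (x j) (y (n - j)%N).

Lemma conv_rev (U V : Type) (W : zmodType) (f : U -> V -> W) x y n :
  conv f x y n = \sum_(j < n.+1) f (x (n - j)%N) (y j).
Proof.
rewrite /conv (reindex_inj rev_ord_inj) /=.
by apply: eq_bigr => j _; rewrite (sub_ordK j).
Qed.

Lemma convA (U V W UV VW T : zmodType) (f : U -> VW -> T) (g : V -> W -> VW)
    (h : UV -> W -> T) (k : U -> V -> UV) :
    (forall a, {morph f a : b c / b + c}) -> (forall a, f a 0 = 0) ->
    (forall c, {morph h^~ c : a b / a + b}) -> (forall c, h 0 c = 0) ->
    (forall a b c, f a (g b c) = h (k a b) c) ->
  forall x y z, conv f x (conv g y z) = conv h (conv k x y) z.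
Proof.
move=> fD f0 hD h0 fg x y z; apply/funext => i.
rewrite [RHS]conv_rev [LHS]/conv.
pose coef3 j l := f (x j) (g (y (i - j - l)%N) (z l)).
transitivity (\sum_(j < i.+1) \sum_(l < i.+1 | (l <= i - j)%N) coef3 j l).
  apply: eq_bigr => /= j _.
  rewrite conv_rev (big_morph _ (fD _) (f0 _)).
  by rewrite (big_ord_narrow_leq (leq_subr _ _)).
rewrite (exchange_big_dep predT) //=; apply: eq_bigr => l _.
transitivity (\sum_(j < i.+1 | (j <= i - l)%N) coef3 j l).
  apply: eq_bigl => j; rewrite -ltnS -(ltnS j) -!subSn ?leq_ord //.
  by rewrite -subn_gt0 -(subn_gt0 j) -!subnDA addnC.
rewrite (big_ord_narrow_leq (leq_subr _ _)) /conv (big_morph _ (hD _) (h0 _)).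
by apply: eq_bigr => j _; rewrite /coef3 -!subnDA addnC fg.
Qed.

Lemma convDl (U : zmodType) (V : Type) (W : zmodType) (f : U -> V -> W) :
    (forall v, {morph f^~ v : a b / a + b}) ->
  forall y, {morph conv f ^~ y : x1 x2 / x1 + x2}.
Proof.
move=> fD y x1 x2; apply/funext => n.
by rewrite [RHS]/GRing.add /= -big_split; apply: eq_bigr => j _; rewrite fD.
Qed.

Lemma convDr (U : Type) (V : zmodType) (W : zmodType) (f : U -> V -> W) :
    (forall u, {morph f u : a b / a + b}) ->
  forall x, {morph conv f x : y1 y2 / y1 + y2}.
Proof.
move=> fD x y1 y2; apply/funext => n.
by rewrite [RHS]/GRing.add /= -big_split; apply: eq_bigr => j _; rewrite fD.
Qed.

End Convolution.

Section SeriesRing.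
Variable K : comNzRingType.

Definition fps_one : fps K := fun n => (n == 0)%:R.
Definition fps_mul : fps K -> fps K -> fps K := conv *%R.

Fact fps_mulA : associative fps_mul.
Proof.
apply: convA.
- exact: mulrDr.
- exact: mulr0.
- by move=> c a b; rewrite mulrDl.
- exact: mul0r.
- exact: mulrA.
Qed.

Fact fps_mulC : commutative fps_mul.
Proof.
move=> x y; apply/funext => n.
by rewrite /fps_mul conv_rev; apply: eq_bigr => j _; rewrite mulrC.
Qed.

Fact fps_mul1 : left_id fps_one fps_mul.
Proof.
move=> x; apply/funext => n.
rewrite /fps_mul /conv big_ord_recl /= mul1r subn0.
by rewrite big1 ?addr0 // => j _; rewrite mul0r.
Qed.

Fact fps_mulDl : left_distributive fps_mul +%R.
Proof.
move=> x y z.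
by rewrite [LHS](@convDl _ _ _ *%R) // => c a b; rewrite mulrDl.
Qed.

Fact fps_one_neq0 : fps_one != 0.
Proof. by apply/eqP => /(congr1 (@^~ 0%N)) /eqP; rewrite oner_eq0. Qed.

HB.instance Definition _ := GRing.Zmodule_isComNzRing.Build (fps K)
  fps_mulA fps_mulC fps_mul1 fps_mulDl fps_one_neq0.

Variable A : lmodType K.

Definition fps_scale : fps K -> fps A -> fps A := conv *:%R.

Fact fps_scaleA (a b : fps K) (x : fps A) :
  fps_scale a (fps_scale b x) = fps_scale (a * b) x.
Proof.
apply: convA.
- exact: scalerDr.
- exact: scaler0.
- by move=> c r s; rewrite scalerDl.
- exact: scale0r.
- exact: scalerA.
Qed.

Fact fps_scale1 : left_id (1 : fps K) fps_scale.
Proof.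
move=> x; apply/funext => n.
rewrite /fps_scale /conv big_ord_recl /= scale1r subn0.
by rewrite big1 ?addr0 // => j _; rewrite scale0r.
Qed.

Fact fps_scaleDr : right_distributive fps_scale +%R.
Proof. by move=> a; apply: convDr => r u v; rewrite scalerDr. Qed.

Fact fps_scaleDl (x : fps A) : {morph fps_scale^~ x : a b / a + b}.
Proof. by apply: convDl => u r s; rewrite scalerDl. Qed.

HB.instance Definition _ := GRing.Zmodule_isLmodule.Build (fps K) (fps A)
  fps_scaleA fps_scale1 fps_scaleDr fps_scaleDl.

End SeriesRing.

(* The K[[t]]-linear extension of a K-linear map. *)
Definition fps_map (K : comNzRingType) (A B : lmodType K) (f : {linear A -> B})
    (x : fps A) : fps B :=
  fun n => f (x n).

Fact fps_map_is_linear (K : comNzRingType) (A B : lmodType K)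
  (f : {linear A -> B}) : linear (fps_map f).
Proof.
move=> a x y; apply/funext => n.
rewrite /fps_map [X in f X]/GRing.add [RHS]/GRing.add /= raddfD raddf_sum.
by congr (_ + _); apply: eq_bigr => j _; exact: linearZZ.
Qed.

HB.instance Definition _ (K : comNzRingType) (A B : lmodType K)
    (f : {linear A -> B}) :=
  GRing.isLinear.Build (fps K) (fps A) (fps B) *:%R (fps_map f)
    (fps_map_is_linear f).

(* \sum_i mu_i t^i as a map on A[[t]] x A[[t]], each mu_i being extended to
   series by [conv]; multiplying by t^i shifts coefficients by i. *)
Definition op_series (A : zmodType) (mu : nat -> A -> A -> A) (x y : fps A) :
    fps A :=
  fun n => \sum_(i < n.+1) conv (mu i) x y (n - i)%N.

Definition is_bilinear (R : comNzRingType) (A : lmodType R) (m : A -> A -> A) :=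
  bilinear_for *:%R *:%R m.

(* Algebras are not required to be unital. *)
Definition assoc_algebra (R : comNzRingType) (A : lmodType R)
    (m : A -> A -> A) : Prop :=
  is_bilinear m /\ associative m.

Definition hom_assoc_algebra (R : comNzRingType) (A : lmodType R)
    (m : A -> A -> A) (alpha : {linear A -> A}) : Prop :=
  is_bilinear m /\
  forall x y z, m (m x y) (alpha z) = m (alpha x) (m y z).

(* In the two records below the last field is about A[[t]] as a module over
   K[[t]]: it contains K[[t]]-bilinearity. *)
Record assoc_deformation (K : fieldType) (A : lmodType K) (mu0 : A -> A -> A)
    (mu : nat -> A -> A -> A) (star : fps A -> fps A -> fps A) : Prop := {
  adef_base : assoc_algebra mu0;
  adef_coef_bilinear : forall i, is_bilinear (mu i);
  adef_coef0 : mu 0%N =2 mu0;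
  adef_series : star =2 op_series mu;
  adef_algebra : @assoc_algebra (fps K) (fps A) star
}.

Record hom_assoc_deformation (K : fieldType) (A : lmodType K)
    (nu0 : A -> A -> A) (alpha : {linear A -> A})
    (nu : nat -> A -> A -> A) (nu_t : fps A -> fps A -> fps A) : Prop := {
  hdef_base : hom_assoc_algebra nu0 alpha;
  hdef_coef_bilinear : forall i, is_bilinear (nu i);
  hdef_coef0 : nu 0%N =2 nu0;
  hdef_series : nu_t =2 op_series nu;
  hdef_algebra : @hom_assoc_algebra (fps K) (fps A) nu_t (fps_map alpha)
}.

(* Main.v *)
Require Import Defs.
From mathcomp Require Import all_boot all_algebra.
From mathcomp Require Import boolp.

Set Implicit Arguments.
Unset Strict Implicit.
Unset Printing Implicit Defensive.

Import GRing.Theory.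
Local Open Scope ring_scope.

(** This is the twisting principle: composing an associative product with a multiplicative linear
    map [alpha] gives a Hom-associative product. It holds over any commutative ring, so it is used
    twice: over [K] for [mu0], and over [K[[t]]] for [star] with the extended map [fps_map alpha].
    The latter is multiplicative for [star] because [alpha] commutes with every [mu i]. *)

Lemma is_bilinear_comp (R : comNzRingType) (A : lmodType R) (m : A -> A -> A)
    (alpha : {linear A -> A}) :
  is_bilinear m -> is_bilinear (fun x y => alpha (m x y)).
Proof.
by case=> ml mr; split=> [u|u] a x y; [rewrite ml linearP | rewrite mr linearP].
Qed.

Lemma hom_assoc_algebra_twist (R : comNzRingType) (A : lmodType R)
    (m : A -> A -> A) (alpha : {linear A -> A}) :
  assoc_algebra m -> {morph alpha : x y / m x y} ->
  hom_assoc_algebra (fun x y => alpha (m x y)) alpha.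
Proof.
case=> m_bil mA alphaM; split=> [|x y z]; first exact: is_bilinear_comp.
(* Pulling [alpha] out of the products turns both sides into [alpha] applied twice to a triple
   product for [m]. *)
by rewrite -!alphaM mA.
Qed.

(** Each coefficient is a finite sum of values of the [mu i], so additivity of [f] suffices. *)
Lemma fps_map_op_series (K : comNzRingType) (A : lmodType K)
    (f : {linear A -> A}) (mu : nat -> A -> A -> A) (x y : fps A) :
  fps_map f (op_series mu x y) = op_series (fun i u v => f (mu i u v)) x y.
Proof.
apply/funext => n; rewrite /fps_map /op_series raddf_sum.
by apply: eq_bigr => i _; rewrite /conv raddf_sum.
Qed.

Lemma op_series_map_morph (K : comNzRingType) (A : lmodType K)
    (f : {linear A -> A}) (mu : nat -> A -> A -> A) :
  (forall i, {morph f : u v / mu i u v}) ->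
  {morph fps_map f : x y / op_series mu x y}.
Proof.
move=> fM x y; rewrite fps_map_op_series; apply/funext => n.
by apply: eq_bigr => i _; apply: eq_bigr => j _; rewrite fM.
Qed.

Theorem theorem4p8 (K : fieldType) (charK0 : [pchar K] =i pred0)
    (A : lmodType K) (mu0 : A -> A -> A) (mu : nat -> A -> A -> A)
    (star : fps A -> fps A -> fps A) (alpha : {linear A -> A}) :
  assoc_deformation mu0 mu star ->
  (forall (i : nat) (x y : A), alpha (mu i x y) = mu i (alpha x) (alpha y)) ->
  hom_assoc_deformation
    (fun x y => alpha (mu0 x y)) alpha
    (fun i x y => alpha (mu i x y))
    (fun x y => fps_map alpha (star x y)).
Proof.
case=> mu0A mu_bil mu0E starE starA alphaM; split.
(* Multiplicativity for [mu0] is the case [i = 0] of [alphaM]. *)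
- by apply: hom_assoc_algebra_twist => // x y; rewrite -!mu0E alphaM.
- by move=> i; apply: is_bilinear_comp.
- by move=> x y; rewrite mu0E.
- by move=> x y; rewrite starE fps_map_op_series.
(* The same twist, now with scalars [fps K]. *)
- apply: (hom_assoc_algebra_twist (alpha := fps_map alpha)) => // x y.
  by rewrite !starE; apply: op_series_map_morph.
Qed.
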